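(* Let $U=(0,0)$, $A=(192,144)$, $V=(384,0)$, $B=(192,-256)$. Then the set of rational points $P$ on the open segment $UV$ such that the Euclidean distances $PU,PV,PA,PB$ are all rational is exactly $\{(192,0)\}$.
   Context: A rational point is a point with both coordinates in $\mathbb{Q}$. *)

(* Defs.v *)
From mathcomp Require Import all_boot all_order all_algebra.
From mathcomp Require Import classical_sets reals.
Set Implicit Arguments.
Unset Strict Implicit.
Unset Printing Implicit Defensive.
Import Order.TTheory GRing.Theory Num.Theory.
Local Open Scope classical_set_scope.
Local Open Scope ring_scope.

Definition rational_point (R : realType) : set (R * R) :=
  @rational R `*` @rational R.

(* The norm that the library puts on R * R is the sup norm. *)
Definition euclidean_dist (R : realType) (P Q : R * R) : R :=
  Num.sqrt ((P.1 - Q.1) ^+ 2 + (P.2 - Q.2) ^+ 2).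

Definition open_segment (R : realType) (P Q : R * R) : set (R * R) :=
  [set ((1 - t) * P.1 + t * Q.1, (1 - t) * P.2 + t * Q.2) |
    t in [set t : R | 0 < t < 1]].

(* Main.v *)
Require Import Defs.
From mathcomp Require Import all_boot all_order all_algebra.
From mathcomp Require Import classical_sets reals.
From mathcomp Require Import zify ring lra.

(** Put [d = x(P) - 192]; then [d^2 + 144^2] and [d^2 + 256^2] are rational
    squares.  If [d] and [d^2 - 192^2] are nonzero, [w = (d^2 - 192^2) / (16 d)]
    (a 2-isogeny from [Y^2 = X(X+81)(X+256)]) is nonzero and [w^2 + 24^2],
    [w^2 + 25^2] are both squares, that is, [w^2] is the abscissa of a double on
    [Y^2 = X(X+24^2)(X+25^2)].  This is impossible by descent:
    with [w = x / y], [p^2 = x^2 + 576 y^2] and [q^2 = x^2 + 625 y^2], the classes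
    of [p + x], [q + x], [q + p] modulo squares are those of a half of the point;
    local conditions at 2, 3, 5, 7 leave only the trivial class, and the half is
    then a smaller solution.  The swap [w -> 600 / w] allows [x] to be odd. *)

Set Implicit Arguments.
Unset Strict Implicit.
Unset Printing Implicit Defensive.

(** * Factoring a product that is a square *)

Lemma coprime_mul_sqr u v m : coprime u v -> u * v = m ^ 2 ->
  gcdn u m ^ 2 = u.
Proof.
move=> cuv uv; transitivity (gcdn (u ^ 2) (m ^ 2)); last first.
  by rewrite -uv -muln_gcdr (eqP cuv) muln1.
have [->|m0] := posnP m; first by rewrite exp0n ?gcdn0.
have [->|u0] := posnP u; first by rewrite exp0n ?gcd0n.
have g0 : 0 < gcdn u m by rewrite gcdn_gt0 u0.
have [[u' eu] [m' em]] := (dvdnP (dvdn_gcdl u m), dvdnP (dvdn_gcdr u m)).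
rewrite {2}eu {3}em !expnMn -muln_gcdl.
suff /eqP -> : coprime (u' ^ 2) (m' ^ 2) by rewrite mul1n.
rewrite coprimeXl ?coprimeXr //.
by rewrite /coprime -(eqn_pmul2r g0) mul1n muln_gcdl -eu -em.
Qed.

(** The gcd [g] of [u] and [d + u] divides [d], hence is prime to [z]; as [g ^ 2] divides
    [(N * z) ^ 2], it divides [N]. The cofactors are coprime with square product. So only divisors
    of [N] occur as square classes. *)
Lemma sqr_split N z d u : 0 < u -> coprime d z -> u * (d + u) = (N * z) ^ 2 ->
  exists g a b, [/\ g %| N, g %| d, d + u = g * a ^ 2 & u = g * b ^ 2].
Proof.
move=> u0 cdz uv; set g := gcdn u (d + u).
have g0 : 0 < g by rewrite gcdn_gt0 u0.
have gu : g %| u := dvdn_gcdl _ _.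
have gdu : g %| d + u := dvdn_gcdr _ _.
have gd : g %| d by rewrite -(dvdn_addl _ gu).
have gN : g %| N.
  rewrite -(@Gauss_dvdl g N z) ?(coprime_dvdl gd) //.
  by rewrite -(dvdn_pexp2r _ _ (isT : 0 < 2)) -uv dvdn_mul.
have [M eM] := dvdnP gN; have [s es] := dvdnP gu; have [t et] := dvdnP gdu.
have cst : coprime s t.
  by rewrite /coprime -(eqn_pmul2r g0) mul1n muln_gcdl -es -et.
have st : s * t = (M * z) ^ 2.
  apply/eqP; rewrite -(eqn_pmul2r (_ : 0 < g ^ 2)) ?expn_gt0 ?g0 //.
  by apply/eqP; move: uv; rewrite et es eM; nia.
have e1 := coprime_mul_sqr cst st.
have e2 := coprime_mul_sqr (etrans (coprime_sym t s) cst)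
  (etrans (mulnC t s) st).
exists g, (gcdn t (M * z)), (gcdn s (M * z)).
by rewrite e1 e2 ![g * _]mulnC.
Qed.

(** * Integral solutions and obstructions at 3, 5 and 7 *)

Definition solution x y :=
  (exists p, x ^ 2 + 576 * y ^ 2 = p ^ 2) /\
  (exists q, x ^ 2 + 625 * y ^ 2 = q ^ 2).

(** The boolean hypothesis, closed by computation at each use, says that the form has only the
    trivial zero modulo [p]. *)
Lemma dvdn_sqrD p k a b : 0 < p ->
  all (fun i => all (fun j => (p %| i ^ 2 + k * j ^ 2) ==> (i == 0) && (j == 0))
    (iota 0 p)) (iota 0 p) ->
  p %| a ^ 2 + k * b ^ 2 -> (p %| a) && (p %| b).
Proof.
move=> p0 /allP chk.
have lt c : c %% p \in iota 0 p by rewrite mem_iota ltn_mod.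
rewrite /dvdn -modnDm -(modnMmr k) -(modnXm 2 p a) -(modnXm 2 p b).
rewrite modnMmr modnDm.
by apply: implyP (allP (chk _ (lt a)) _ (lt b)).
Qed.

Lemma coprime_prime_dvd p x y : prime p -> coprime x y ->
  p %| x -> p %| y -> False.
Proof.
move=> pp cxy px py; have : p %| gcdn x y by rewrite dvdn_gcd px.
by rewrite (eqP cxy) dvdn1; move: pp => /[swap] /eqP ->.
Qed.

(** Modulo 7, 576 is 2, and -2 is not a square. *)
Lemma solution_ndvd7 x y : coprime x y -> ~~ (7 %| x ^ 2 + 576 * y ^ 2).
Proof.
move=> cxy; apply/negP => h; have : 7 %| x ^ 2 + 2 * y ^ 2 by lia.
move=> /(@dvdn_sqrD 7 2 _ _ isT isT) /andP[].
exact: coprime_prime_dvd.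
Qed.

(* Modulo 3, [p = +-x], so [q + p] agrees with one of [q +- x], while 2 and 10
   differ by a non-square. *)
Lemma split5_mod3 x y p q b b' c c' : coprime x y ->
  x ^ 2 + 576 * y ^ 2 = p ^ 2 -> x ^ 2 + 625 * y ^ 2 = q ^ 2 ->
  q + x = 10 * b ^ 2 -> q = x + 10 * b' ^ 2 ->
  q + p = 2 * c ^ 2 -> q = p + 2 * c' ^ 2 -> False.
Proof.
move=> cxy hp hq e1 e2 e3 e4.
have sq3 s t : 3 %| s ^ 2 + t ^ 2 -> 3 %| s ^ 2 /\ 3 %| t ^ 2.
  rewrite -[t ^ 2 in X in X -> _]mul1n.
  by move=> /(@dvdn_sqrD 3 1 _ _ isT isT) /andP[? ?]; rewrite !dvdn_exp.
have xp : x <= p by rewrite -leq_sqr -hp leq_addr.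
have : 3 %| (p - x) * (p + x).
  by rewrite -subn_sqr -hp addKn dvdn_mulr.
have no3 : 3 %| x /\ 3 %| q -> False.
  case=> x3 q3.
  have : 3 %| y ^ 2.
    move: hq (dvdn_exp (isT : 0 < 2) x3) (dvdn_exp (isT : 0 < 2) q3).
    by clear; lia.
  rewrite Euclid_dvdX // andbT.
  exact: (coprime_prime_dvd _ cxy x3).
rewrite Euclid_dvdM // => /orP[] h.
- have [] := sq3 b c; first by clear -h e1 e3 xp; lia.
  have [] := sq3 b' c'; first by clear -h e2 e4 xp; lia.
  by clear -no3 e1 e2; lia.
- have [] := sq3 b c'; first by clear -h e1 e4; lia.
  have [] := sq3 b' c; first by clear -h e2 e3; lia.
  by clear -no3 e1 e2; lia.
Qed.

(* Modulo 5, [q = +-x], so [q + p] agrees with one of [p +- x], while 2 and 6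
   differ by a non-square. *)
Lemma split3_mod5 x y p q a a' c c' : coprime x y ->
  x ^ 2 + 576 * y ^ 2 = p ^ 2 -> x ^ 2 + 625 * y ^ 2 = q ^ 2 ->
  p + x = 6 * a ^ 2 -> p = x + 6 * a' ^ 2 ->
  q + p = 2 * c ^ 2 -> q = p + 2 * c' ^ 2 -> False.
Proof.
move=> cxy hp hq e1 e2 e3 e4.
have sq5 s t : 5 %| s ^ 2 + 3 * t ^ 2 -> 5 %| s ^ 2 /\ 5 %| t ^ 2.
  by move=> /(@dvdn_sqrD 5 3 _ _ isT isT) /andP[? ?]; rewrite !dvdn_exp.
have sq5' s t : 5 %| s ^ 2 + 2 * t ^ 2 -> 5 %| s ^ 2 /\ 5 %| t ^ 2.
  by move=> /(@dvdn_sqrD 5 2 _ _ isT isT) /andP[? ?]; rewrite !dvdn_exp.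
have xq : x <= q by rewrite -leq_sqr -hq leq_addr.
have : 5 %| (q - x) * (q + x).
  by rewrite -subn_sqr -hq addKn dvdn_mulr.
have no5 : 5 %| x /\ 5 %| p -> False.
  case=> x5 p5.
  have : 5 %| y ^ 2.
    move: hp (dvdn_exp (isT : 0 < 2) x5) (dvdn_exp (isT : 0 < 2) p5).
    by clear; lia.
  rewrite Euclid_dvdX // andbT.
  exact: (coprime_prime_dvd _ cxy x5).
rewrite Euclid_dvdM // => /orP[] h.
- have [] := sq5 a c; first by clear -h e1 e3 xq; lia.
  have [] := sq5' a' c'; first by clear -h e2 e4 xq; lia.
  by clear -no5 e1 e2; lia.
- have [] := sq5' a c'; first by clear -h e1 e4; lia.
  have [] := sq5 a' c; first by clear -h e2 e3; lia.
  by clear -no5 e1 e2; lia.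
Qed.

(** * Parity and 2-adic valuations *)

Lemma solution_odd_dvd4 x y : solution x y -> odd y -> 4 %| x.
Proof.
case=> [_ [q hq]] oy.
have := divn_eq x 4; have := ltn_pmod x (isT : 0 < 4).
have := divn_eq q 4; have := ltn_pmod q (isT : 0 < 4).
(* Since 625 and [y ^ 2] are 1 modulo 8, [q ^ 2] is [x ^ 2 + 1] there; squares being 0, 1 or 4,
   [x ^ 2] must be 0. *)
have [k ek] : exists k, y ^ 2 = 8 * k + 1.
  have := divn_eq y 4; have := ltn_pmod y (isT : 0 < 4).
  move: (y %/ 4) (y %% 4) => k [|[|[|[|]]]] //= _ ey; move: oy;
    rewrite ey; try (by lia) => _.
  - by exists (2 * k ^ 2 + k); nia.
  - by exists (2 * k ^ 2 + 3 * k + 1); nia.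
rewrite /dvdn; move: (x %/ 4) (x %% 4) (q %/ 4) (q %% 4) => m r n s.
move=> lts eq ltr ex; rewrite eq ex ek {eq ex} in hq.
by case: r ltr hq => [|[|[|[|]]]] //= _ hq;
  case: s lts hq => [|[|[|[|]]]] //= _ hq; exfalso; move: hq; clear; nia.
Qed.


(** Divide by the gcd: were the reduced [y'] odd, [x'] would be a multiple of 4, against the
    hypothesis on [x]. *)
Lemma solution_reduce x y : 0 < y -> ~~ (4 * gcdn x y %| x) -> solution x y ->
  exists x' y', [/\ 0 < y' <= y, ~~ odd y', odd x', coprime x' y' &
    solution x' y'].
Proof.
move=> y0 nx sol; set g := gcdn x y in nx.
have g0 : 0 < g by rewrite gcdn_gt0 y0 orbT.
have [[x' ex] [y' ey]] := (dvdnP (dvdn_gcdl x y), dvdnP (dvdn_gcdr x y)).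
rewrite -/g in ex ey.
have sol' : solution x' y'.
  have red N r : x ^ 2 + N * y ^ 2 = r ^ 2 ->
      exists r', x' ^ 2 + N * y' ^ 2 = r' ^ 2.
    move=> er; have /dvdnP[r' er'] : g %| r.
      rewrite -(dvdn_pexp2r _ _ (isT : 0 < 2)) -er ex ey !expnMn.
      by rewrite mulnA -mulnDl dvdn_mull.
    exists r'; apply/eqP.
    rewrite -(eqn_pmul2r (_ : 0 < g ^ 2)) ?expn_gt0 ?g0 //.
    by rewrite -expnMn -er' -er ex ey !expnMn mulnDl mulnA.
  by case: sol => [[p hp] [q hq]]; split; [apply: red hp|apply: red hq].
have cxy : coprime x' y'.
  by rewrite /coprime -(eqn_pmul2r g0) mul1n muln_gcdl -ex -ey.
have ey' : ~~ odd y'.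
  apply: contra nx => oy; rewrite {1}ex dvdn_pmul2r //.
  exact: solution_odd_dvd4 sol' oy.
exists x', y'; split => //.
- by apply/andP; split; nia.
- apply: contraT => ox; exfalso.
  by apply: (@coprime_prime_dvd 2 _ _ _ cxy); rewrite // dvdn2.
Qed.

(* A reduced solution with odd [y] has [4 %| x]; for two solutions with ratios
   multiplying to 600, whose 2-adic valuation is 3, this cannot happen twice. *)
Lemma solution_of_swap x1 y1 x2 y2 : 0 < y1 -> 0 < y2 ->
  x1 * x2 = 600 * (y1 * y2) -> solution x1 y1 -> solution x2 y2 ->
  exists x' y', [/\ 0 < y' <= maxn y1 y2, ~~ odd y', odd x', coprime x' y' &
    solution x' y'].
Proof.
move=> y10 y20 e s1 s2.
have [d1|n1] := boolP (4 * gcdn x1 y1 %| x1); last first.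
  have [x [y [/andP[? ?] ? ? ? ?]]] := solution_reduce y10 n1 s1.
  exists x, y; split=> //; apply/andP; split=> //.
  by rewrite leq_max; apply/orP; left.
have [d2|n2] := boolP (4 * gcdn x2 y2 %| x2); last first.
  have [x [y [/andP[? ?] ? ? ? ?]]] := solution_reduce y20 n2 s2.
  exists x, y; split=> //; apply/andP; split=> //.
  by rewrite leq_max; apply/orP; right.
exfalso.
(* The gcd has the smaller of the two valuations, which here must be that of [y]. The two gaps add
   up to at least 4, but 600 allows only 3. *)
have logy x y : 0 < x -> 0 < y -> 4 * gcdn x y %| x -> logn 2 y + 2 <= logn 2 x.
  move=> x0 y0 h.
  have g0 : 0 < gcdn x y by rewrite gcdn_gt0 y0 orbT.
  have := dvdn_leq_log 2 x0 h; rewrite lognM // logn_gcd //.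
  rewrite (_ : logn 2 4 = 2) //; move: (logn 2 x) (logn 2 y).
  by clear; lia.
have x0 : 0 < x1 * x2 by rewrite e !muln_gt0 y10.
move: (x0); rewrite muln_gt0 => /andP[x10 x20].
have := logy _ _ x10 y10 d1; have := logy _ _ x20 y20 d2.
have := congr1 (logn 2) e; rewrite !lognM ?muln_gt0 ?y10 //.
by rewrite (_ : logn 2 600 = 3) //; lia.
Qed.

(** * The descent on [y] *)

Lemma no_coprime_solution x y : odd x -> ~~ odd y -> 0 < y -> coprime x y ->
  ~ solution x y.
Proof.
elim/ltn_ind: y x => y IH x ox ey y0 cxy [[p hp] [q hq]].
have [z ez] : exists z, y = 2 * z by exists y./2; lia.
have z0 : 0 < z by lia.
have cxz : coprime x z by apply: coprime_dvdr cxy; rewrite ez dvdn_mull.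
have op : odd p by have := congr1 odd hp; rewrite oddD oddM !oddX /= ox => <-.
have oq : odd q.
  by have := congr1 odd hq; rewrite oddD oddM !oddX /= ox (negbTE ey) => <-.
have xp : x < p by rewrite -ltn_sqr -hp -[X in X < _]addn0 ltn_add2l; lia.
have pq : p < q by rewrite -ltn_sqr -hp -hq ltn_add2l; lia.
have [u eu] : exists u, p = x + 2 * u by exists (p - x)./2; lia.
have [w ew] : exists w, q = x + 2 * w by exists (q - x)./2; lia.
have [t et] : exists t, q = p + 2 * t by exists (q - p)./2; lia.
have cpz : coprime p z.
  rewrite -(@coprime_pexpl 2) // -hp ez coprime_sym.
  have -> : x ^ 2 + 576 * (2 * z) ^ 2 = 2304 * z * z + x ^ 2 by lia.
  by rewrite /coprime gcdnMDl -/(coprime _ _) coprime_sym coprimeXl.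
(* These are the differences [p ^ 2 - x ^ 2], [q ^ 2 - x ^ 2] and [q ^ 2 - p ^ 2] divided by 4; the
   last uses 625 - 576 = 49. *)
have ru : u * (x + u) = (24 * z) ^ 2 by move: hp; rewrite eu ez; clear; lia.
have rw : w * (x + w) = (25 * z) ^ 2 by move: hq; rewrite ew ez; clear; lia.
have rt : t * (p + t) = (7 * z) ^ 2.
  have : p ^ 2 + 49 * y ^ 2 = q ^ 2 by move: hp hq; clear; lia.
  by rewrite et ez; clear; lia.
have u0 : 0 < u by clear -xp eu; lia.
have w0 : 0 < w by clear -xp pq ew; lia.
have t0 : 0 < t by clear -pq et; lia.
have [g [a [a' [gN gx ea ea']]]] := sqr_split u0 cxz ru.
have [h [b [b' [hN hx eb eb']]]] := sqr_split w0 cxz rw.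
have [k [c [c' [kN kp ec ec']]]] := sqr_split t0 cpz rt.
have k1 : k = 1.
  apply/eqP; have : k \in [:: 1; 7].
    by rewrite -[[:: _; _]]/(divisors 7) -dvdn_divisors.
  rewrite !inE => /orP[] // /eqP k7.
  case/negP: (solution_ndvd7 cxy); rewrite hp -k7.
  by rewrite dvdn_exp.
subst k; rewrite !mul1n in ec ec'.
have qp2 : q + p = 2 * c ^ 2 by rewrite -ec et; clear; lia.
have qp2' : q = p + 2 * c' ^ 2 by rewrite -ec' et.
(* Classes 1 and 25 are squares; class 5 is excluded modulo 3. *)
have {h b b' hN hx eb eb'} [b [b' [eb eb']]] :
    exists b b', x + w = b ^ 2 /\ w = b' ^ 2.
  have : h \in [:: 1; 5; 25].
    by rewrite -[[:: _; _; _]]/(divisors 25) -dvdn_divisors.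
  rewrite !inE => /or3P[] /eqP eh; subst h.
  - by exists b, b'; rewrite eb {1}eb' !mul1n.
  - exfalso; apply: (@split5_mod3 _ _ _ _ b b' c c' cxy hp hq) => //.
    + by rewrite ew; move: eb; clear; lia.
    + by rewrite ew {1}eb'; clear; lia.
  - by exists (5 * b), (5 * b'); rewrite eb {1}eb' !expnMn.
(* As [g] divides the odd [x], only 1 and 3 remain; 3 is excluded modulo 5. *)
have {g a a' gN gx ea ea'} [a [a' [ea ea']]] :
    exists a a', x + u = a ^ 2 /\ u = a' ^ 2.
  have og : odd g by apply: dvdn_odd gx ox.
  have : g \in [:: 1; 3].
    rewrite -[[:: _; _]]/[seq i <- divisors 24 | odd i].
    by rewrite mem_filter og -dvdn_divisors.
  rewrite !inE => /orP[] /eqP eg; subst g.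
    by exists a, a'; rewrite ea {1}ea' !mul1n.
  exfalso; apply: (@split3_mod5 _ _ _ _ a a' c c' cxy hp hq) => //.
  + by rewrite eu; move: ea; clear; lia.
  + by rewrite eu {1}ea'; clear; lia.
(* Hence [c ^ 2 = p + t = x + u + w], the common factor of the sums in [s1] and [s2]: for instance
   [(x + u) * (x + w) + u * (x + u) = (x + u) * (x + u + w)]. *)
have ewt : w = u + t by clear -eu ew et; lia.
have e24 : 576 * z ^ 2 = u * (x + u) by rewrite ru expnMn.
have e25 : 625 * z ^ 2 = w * (x + w) by rewrite rw expnMn.
(* The halves [ab / z] and [a'b' / z] come from [x] and [-x], and are exchanged by
   the swap. *)
have s1 : solution (a * b) z.
  split; [exists (a * c)|exists (b * c)]; rewrite !expnMn -ea -eb -ec.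
  + by rewrite e24 eu ewt; clear; lia.
  + by rewrite e25 eu ewt; clear; lia.
have s2 : solution (a' * b') z.
  split; [exists (a' * c)|exists (b' * c)]; rewrite !expnMn -ea' -eb' -ec.
  + by rewrite e24 eu ewt; clear; lia.
  + by rewrite e25 eu ewt; clear; lia.
have e12 : a * b * (a' * b') = 600 * (z * z).
  apply/eqP; rewrite -eqn_sqr !expnMn -ea -eb -ea' -eb'; apply/eqP.
  by move: ru rw; clear; nia.
have [x' [y' [/andP[y'0 y'z] ? ? ? ?]]] := solution_of_swap z0 z0 e12 s1 s2.
by apply: (IH y' _ x') => //; rewrite maxnn in y'z; clear -y'z ez z0; lia.
Qed.

(** Since 600 = 24 * 25, the swap exchanges the two conditions up to the square factors 576 and 625;
    a solution and its swap have ratios with product 600. *)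
Lemma no_solution x y : 0 < x -> 0 < y -> ~ solution x y.
Proof.
move=> x0 y0 sol.
have sol' : solution (600 * y) x.
  case: sol => [[p hp] [q hq]]; split; [exists (24 * q)|exists (25 * p)];
    rewrite !expnMn -?hp -?hq; clear; lia.
have e : x * (600 * y) = 600 * (y * x) by rewrite mulnCA [x * y]mulnC.
have [x' [y' [/andP[y'0 _] ? ? ? ?]]] := solution_of_swap y0 x0 e sol sol'.
exact: (@no_coprime_solution x' y').
Qed.

(** * Passage to rational numbers and to the plane *)

Import Order.TTheory GRing.Theory Num.Theory.
Local Open Scope classical_set_scope.
Local Open Scope ring_scope.

Lemma common_denominator (w p q : rat) : exists (n : nat) (a b c : int),
  [/\ (0 < n)%N, w = a%:~R / n%:R, p = b%:~R / n%:R & q = c%:~R / n%:R].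
Proof.
have den (v : rat) : exists m : nat, (0 < m)%N /\ v = (numq v)%:~R / m%:R.
  exists `|denq v|%N; rewrite absz_gt0 denq_neq0; split=> //.
  rewrite -[X in X = _](divq_num_den v); congr (_ / _).
  by rewrite -[in LHS](gtz0_abs (denq_gt0 v)).
have [k [k0 ek]] := den w; have [l [l0 el]] := den p; have [m [m0 em]] := den q.
exists (k * l * m)%N, (numq w * l%:Z * m%:Z), (numq p * k%:Z * m%:Z),
  (numq q * k%:Z * l%:Z).
rewrite !muln_gt0 k0 l0 m0; split=> //.
- by rewrite {1}ek !natrM !intrM; field; rewrite !pnatr_eq0 -!lt0n k0 l0 m0.
- by rewrite {1}el !natrM !intrM; field; rewrite !pnatr_eq0 -!lt0n k0 l0 m0.
- by rewrite {1}em !natrM !intrM; field; rewrite !pnatr_eq0 -!lt0n k0 l0 m0.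
Qed.

Lemma no_rat_solution (w p q : rat) : w != 0 -> w ^+ 2 + 576 = p ^+ 2 ->
  w ^+ 2 + 625 = q ^+ 2 -> False.
Proof.
have [n [a [b [c [n0 -> -> ->]]]]] := common_denominator w p q.
have nR : n%:R != 0 :> rat by rewrite pnatr_eq0 -lt0n.
have clr (N : nat) (r : int) :
    (a%:~R / n%:R) ^+ 2 + N%:R = (r%:~R / n%:R) ^+ 2 :> rat ->
    (`|a| ^ 2 + N * n ^ 2 = `|r| ^ 2)%N.
  move=> e; have {e} : a%:~R ^+ 2 + N%:R * n%:R ^+ 2 = r%:~R ^+ 2 :> rat.
    have -> : r%:~R ^+ 2 = (r%:~R / n%:R) ^+ 2 * n%:R ^+ 2 :> rat by field.
    by rewrite -e; field.
  have abs2 (i : int) : (`|i| ^ 2)%N%:Z = i ^+ 2.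
    by rewrite -abszX gez0_abs ?sqr_ge0.
  move=> e; apply/eqP; rewrite -eqz_nat PoszD PoszM !abs2; apply/eqP.
  by apply: (@intr_inj rat); rewrite intrD intrM !rmorphXn /= -e -natrX.
move=> w0 /clr hp /clr hq.
apply: (@no_solution `|a| n) => //.
  by rewrite absz_gt0; apply: contraNneq w0 => ->; rewrite mulr0z mul0r.
by split; [exists `|b|%N|exists `|c|%N].
Qed.

(** From 16 * 24 = 2 * 192, 16 * 25 = 144 + 256 and 144 * 256 = 192 ^ 2, adding [(16 * 24 * d) ^ 2]
    or [(16 * 25 * d) ^ 2] to [(d ^ 2 - 192 ^ 2) ^ 2] gives [(d ^ 2 + 192 ^ 2) ^ 2] or
    [(s * r) ^ 2]. *)
Lemma rat_kite_diagonal (d s r : rat) :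
  d ^+ 2 + 144 ^+ 2 = s ^+ 2 -> d ^+ 2 + 256 ^+ 2 = r ^+ 2 ->
  d = 0 \/ d ^+ 2 = 192 ^+ 2.
Proof.
move=> hs hr; have [->|d0] := eqVneq d 0; [by left|right].
have [/subr0_eq //|w0] := eqVneq (d ^+ 2 - 192 ^+ 2) 0; exfalso.
apply: (@no_rat_solution ((d ^+ 2 - 192 ^+ 2) / (16 * d))
  ((d ^+ 2 + 192 ^+ 2) / (16 * d)) (s * r / (16 * d))).
- by rewrite mulf_neq0 // invr_eq0 mulf_neq0.
- by field.
- by rewrite [RHS]expr_div_n [(s * r) ^+ 2]exprMn -hs -hr; field.
Qed.

Theorem theorem5p3 (R : realType) :
  let U : R * R := (0, 0) in
  let A : R * R := (192, 144) in
  let V : R * R := (384, 0) in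
  let B : R * R := (192, - 256) in
  [set P : R * R | [/\ rational_point P, open_segment U V P &
    [/\ rational (euclidean_dist P U), rational (euclidean_dist P V),
        rational (euclidean_dist P A) & rational (euclidean_dist P B)]]]
  = [set ((192, 0) : R * R)].
Proof.
move=> U A V B; apply/seteqP; split=> P /=.
  case=> [[[x _ ex] _] [t /= /andP[t0 t1] eP] [_ _ [s _ es] [r _ er]]].
  have e1 : P.1 = t * 384 by rewrite -eP /=; ring.
  have e2 : P.2 = 0 by rewrite -eP /=; ring.
  have pull (u h : rat) (k : R) :
      ratr u = euclidean_dist P (192, k) -> k ^+ 2 = ratr h ^+ 2 ->
      (x - 192) ^+ 2 + h ^+ 2 = u ^+ 2.
    move=> eu ek; apply: (@fmorph_inj _ _ (@ratr R)).
    rewrite rmorphD !rmorphXn rmorphB /= eu /euclidean_dist /= ex e2.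
    rewrite sqr_sqrtr ?addr_ge0 ?sqr_ge0 //.
    by rewrite ratr_nat add0r sqrrN ek.
  have hs : (x - 192) ^+ 2 + 144 ^+ 2 = s ^+ 2.
    by apply: (pull _ _ _ es); rewrite ratr_nat.
  have hr : (x - 192) ^+ 2 + 256 ^+ 2 = r ^+ 2.
    by apply: (pull _ _ _ er); rewrite ratr_nat sqrrN.
  have eP' : P = (ratr x, 0) by rewrite [P]surjective_pairing e2 -ex.
  have [/subr0_eq e|e] := rat_kite_diagonal hs hr.
    by rewrite eP' e ratr_nat.
  (* Here [x - 192] is 192 or -192, so the point is an endpoint, where [t] is 1 or 0. *)
  exfalso; move/eqP: e ex; rewrite e1 eqf_sqr => /orP[] /eqP e.
    have -> : x = 384 by lra.
    by rewrite ratr_nat; clear -t1; lra.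
  have -> : x = 0 by lra.
  by rewrite (ratr_nat _ 0); clear -t0; lra.
have rat_nat (n : nat) : rational (n%:R : R) by exists n%:R; rewrite ?ratr_nat.
have dist (Q : R * R) n : (192 - Q.1) ^+ 2 + Q.2 ^+ 2 = n%:R ^+ 2 ->
    rational (euclidean_dist (192, 0) Q).
  by rewrite /euclidean_dist /= sub0r sqrrN => ->; rewrite sqrtr_sqr normr_nat.
move=> ->; split.
- by split=> /=; [exact: (rat_nat 192) | exact: (rat_nat 0)].
(* The point is the midpoint of the segment. *)
- by exists 2^-1 => /=; [lra | congr pair; lra].
- split.
  + by apply: (dist _ 192%N); rewrite /=; ring.
  + by apply: (dist _ 192%N); rewrite /=; ring.
  + by apply: (dist _ 144%N); rewrite /=; ring.
  + by apply: (dist _ 256%N); rewrite /=; ring.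
Qed.
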